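(* Let $d^*\in D$. Then the optimal objective function value of (APC2-Ry) is equal to $d^*$ if and only if $d^*$ is the smallest possible value of $\delta$ such that there is a feasible solution for $(\mathrm{AFSC})_\delta$ with objective function value at most $p$.
   Context: Given are a finite set of points $N$, a positive integer $p<|N|$, a positive integer $\alpha\le p$, and distances $d_{ij}\ge 0$ for $i,j\in N$ (an instance of the discrete $\alpha$-neighbor $p$-center problem). Let $D=\{d_{ij}: i,j\in N, i\ne j\}=\{d_1,\dots,d_K\}$ with $d_1<d_2<\dots<d_K$, and for $i\in N$ let $D_i=\{d_{ij}: j\in N\setminus\{i\}\}\setminus\{d_1\}$. The semi-relaxation (APC2-Ry), in variables $u_k$ ($k=2,\dots,K$) and $y_j$ ($j\in N$), is: minimize $d_1+\sum_{k=2}^K(d_k-d_{k-1})u_k$ subject to - $\sum_{j\in N}y_j=p$; - $u_{k-1}\ge u_k$ for all $k\in\{3,\dots,K\}$; - $\alpha u_k+\sum_{j\in N\setminus\{i\}: d_{ij}<d_k} y_j\ge \alpha(1-y_i)$ for all $i\in N$ and all $d_k\in D_i$; - $u_k\in\{0,1\}$ for all $k\in\{2,\dots,K\}$; $0\le y_j\le 1$ for all $j\in N$. For $\delta\in\mathbb{R}$, $(\mathrm{AFSC})_\delta$ is the linear program: minimize $\sum_{j\in N}y_j$ subject to $\sum_{j\in N\setminus\{i\}:\, d_{ij}\le\delta} y_j\ge\alpha(1-y_i)$ for all $i\in N$ and $0\le y_j\le1$ for all $j\in N$. *)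

(* Defs.v *)
From mathcomp Require Import all_boot all_order all_algebra.
From mathcomp Require Import classical_sets reals.

Set Implicit Arguments.
Unset Strict Implicit.
Unset Printing Implicit Defensive.

Import Order.TTheory GRing.Theory Num.Theory.
Local Open Scope classical_set_scope.
Local Open Scope ring_scope.

Definition least (R : realType) (S : set R) (x : R) : Prop :=
  S x /\ lbound S x.

(* An attained minimum: in particular, the problem is feasible. *)
Definition optimal_value (R : realType) (T : Type) (feasible : set T)
    (obj : T -> R) (v : R) : Prop :=
  least (obj @` feasible) v.

Section APCenter.
Variables (R : realType) (N : finType) (d : N -> N -> R).

(* D = {d_1 < ... < d_K}: the increasing list of the values d i j, i != j. *)
Definition distances : seq R :=
  sort <=%R (undup [seq d ij.1 ij.2 | ij <- enum {: N * N} & ij.1 != ij.2]).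

Definition ndist : nat := size distances.

(* d_k with the 1-based numbering above; only used for 1 <= k <= K. *)
Definition dist (k : nat) : R := nth 0 distances k.-1.

Definition dists_from (i : N) : set R :=
  [set x | exists2 j, j != i & d i j = x] `\ dist 1.

(* The variables u_2, ..., u_K are the values of u : nat -> R at 2, ..., K;
   the other values of u are never used. *)
Definition APC2Ry_feasible (p alpha : nat) :
    set ((nat -> R) * (N -> R)) :=
  [set uy | let: (u, y) := uy in
    [/\ \sum_j y j = p%:R,
        forall k, (3 <= k <= ndist)%N -> u k <= u k.-1,
        forall (i : N) k, (2 <= k <= ndist)%N -> dists_from i (dist k) ->
          alpha%:R * (1 - y i) <=
          alpha%:R * u k + \sum_(j | (j != i) && (d i j < dist k)) y j,
        forall k, (2 <= k <= ndist)%N -> u k = 0 \/ u k = 1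
      & forall j, 0 <= y j <= 1]].

Definition APC2Ry_objective (uy : (nat -> R) * (N -> R)) : R :=
  dist 1 + \sum_(2 <= k < ndist.+1) (dist k - dist k.-1) * uy.1 k.

Definition AFSC_feasible (alpha : nat) (delta : R) : set (N -> R) :=
  [set y |
    (forall i, alpha%:R * (1 - y i) <=
               \sum_(j | (j != i) && (d i j <= delta)) y j) /\
    (forall j, 0 <= y j <= 1)].

Definition AFSC_objective (y : N -> R) : R := \sum_j y j.

Lemma mem_distances x :
  (x \in distances) <-> exists i j, i != j /\ d i j = x.
Proof.
rewrite mem_sort mem_undup; split.
  by case/mapP=> -[i j]; rewrite mem_filter => /andP[/= nij _] ->; exists i, j.
case=> i [j [nij <-]]; apply/mapP; exists (i, j) => //.
by rewrite mem_filter /= nij mem_enum.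
Qed.

Lemma distances_sorted : sorted <%R distances.
Proof. by rewrite sort_lt_sorted undup_uniq. Qed.

End APCenter.

(* Main.v *)
Require Import Defs.
From mathcomp Require Import all_boot all_order all_algebra.
From mathcomp Require Import classical_sets reals.
From mathcomp Require Import lra.

Import Order.TTheory GRing.Theory Num.Theory.
Local Open Scope classical_set_scope.
Local Open Scope ring_scope.

(** Let S be the set of thresholds delta for which (AFSC)_delta has a solution
    of value at most p.  The theorem compares the minimum of S with the minimum
    of the objective values of (APC2-Ry), and holds because these objective
    values are exactly the distances that belong to S
    ([APC2Ry_values]), while every element of S dominates a distance in S
    ([distance_below_coverable]); so the two sets have the same minimum.

    A feasible binary nonincreasing u is the indicator of an initial segment
    2, ..., m ([nonincreasing_binary]), and then the objective telescopes to
    d_m ([step_objective]).  For k <= m the covering constraints are void, since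
    u_k = 1.  For k > m they say that the points at distance less than d_k from
    i cover i; the strongest one comes from the least distance d_k > d_m seen
    from i, where distance less than d_k means distance at most d_m, which is
    the constraint of (AFSC) at d_m.  If i sees no distance above d_m, then all
    other points count, and their total weight p - y_i is large enough because
    1 <= alpha <= p.  Finally, a solution of (AFSC) of value at most p < |N| can
    be raised to value exactly p, as its constraints are monotone in y
    ([AFSC_raise]). *)

Definition coverable {R : realType} {N : finType} (d : N -> N -> R)
    (p alpha : nat) : set R :=
  [set delta : R | exists2 y, AFSC_feasible d alpha delta y
                            & AFSC_objective y <= p%:R].

Lemma mem_dist {R : realType} {N : finType} (d : N -> N -> R) (m : nat) :
  (0 < m <= ndist d)%N -> dist d m \in distances d.
Proof. by case: m => [//|m] /= lt_m; apply: mem_nth. Qed.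

Lemma distancesP {R : realType} {N : finType} (d : N -> N -> R) (x : R) :
  x \in distances d -> exists2 m, (0 < m <= ndist d)%N & dist d m = x.
Proof.
move=> xD; exists (index x (distances d)).+1; first by rewrite /= index_mem.
by rewrite /dist /= nth_index.
Qed.

Lemma dist_lt {R : realType} {N : finType} (d : N -> N -> R) (a b : nat) :
  (0 < a <= ndist d)%N -> (0 < b <= ndist d)%N ->
  (dist d a < dist d b) = (a < b)%N.
Proof.
case: a b => [//|a] [//|b] /= ha hb.
by rewrite /dist /= (lt_sorted_ltn_nth _ (distances_sorted d)).
Qed.

Lemma nonincreasing_binary {R : numDomainType} (u : nat -> R) (n : nat) :
  (0 < n)%N ->
  (forall k, (3 <= k <= n)%N -> u k <= u k.-1) ->
  (forall k, (2 <= k <= n)%N -> u k = 0 \/ u k = 1) ->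
  exists2 m, (0 < m <= n)%N &
    forall k, (2 <= k <= n)%N -> u k = (k <= m)%N%:R.
Proof.
case: n => // n _; elim: n => [|n IHn] u_le u01.
  by exists 1%N => // k /andP[k2 /(leq_trans k2)].
have [||m /andP[m0 mn] um] := IHn.
- by move=> k /andP[k3 kn]; apply: u_le; rewrite k3 leqW.
- by move=> k /andP[k2 kn]; apply: u01; rewrite k2 leqW.
have [|u0|u1] := u01 n.+2; first by rewrite /= leqnn.
  exists m => [|k]; first by rewrite m0 leqW.
  rewrite [(k <= _)%N]leq_eqVlt ltnS => /andP[k2 /predU1P[->|kn]].
    by rewrite u0 leqNgt ltnS mn.
  by rewrite um ?k2.
(* A drop before n.+1 would give u the value 0 at n.+1, hence also at n.+2. *)
have m_n : m = n.+1.
  apply/eqP; rewrite eqn_leq mn leqNgt; apply/negP => lt_mn.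
  have n_gt0 : (1 < n.+1)%N by apply: leq_ltn_trans m0 lt_mn.
  have := u_le n.+2; rewrite /= !ltnS in n_gt0 *.
  rewrite n_gt0 leqnn => /(_ isT).
  by rewrite u1 (um n.+1) ?ltnS ?n_gt0 ?leqnn // leqNgt lt_mn ler10.
exists n.+2 => [|k]; first by rewrite /= leqnn.
move=> /andP[k2 kn]; rewrite kn.
move: kn; rewrite leq_eqVlt ltnS => /predU1P[->//|kn].
by rewrite um ?k2 // m_n kn.
Qed.

Lemma step_objective {R : realType} {N : finType} (d : N -> N -> R)
    (u : nat -> R) (y : N -> R) (m : nat) :
  (0 < m <= ndist d)%N ->
  (forall k, (2 <= k <= ndist d)%N -> u k = (k <= m)%N%:R) ->
  APC2Ry_objective d (u, y) = dist d m.
Proof.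
move=> /andP[m0 mK] um; rewrite /APC2Ry_objective /=.
rewrite (@big_cat_nat _ _ _ m.+1) //=.
rewrite [X in _ + (_ + X)]big1_seq ?addr0; last first.
  move=> k /andP[_]; rewrite mem_index_iota => /andP[mk kK].
  by rewrite um ?(leq_trans _ mk) // leqNgt mk mulr0.
rewrite (eq_big_nat _ _ (F2 := fun k => dist d k - dist d k.-1)); last first.
  move=> k /andP[k2 km]; rewrite um ?k2 ?(leq_trans _ mK) //.
  by rewrite -ltnS km mulr1.
by rewrite big_add1 /= telescope_sumr // addrC subrK.
Qed.

(** Moving y towards the all-ones vector only helps: the covering sums grow and
    the demands shrink.  Along the segment the total goes from at most p to
    |N| > p, so it takes the value p. *)
Lemma AFSC_raise {R : realType} {N : finType} (d : N -> N -> R)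
    (p alpha : nat) (delta : R) :
  (p < #|N|)%N -> coverable d p alpha delta ->
  exists2 y, AFSC_feasible d alpha delta y & \sum_j y j = p%:R.
Proof.
move=> pN [y [ycov y01]]; rewrite /AFSC_objective; set s := \sum_j y j => sp.
have pN' : p%:R < #|N|%:R :> R by rewrite ltr_nat.
have ns0 : 0 < #|N|%:R - s by lra.
pose t := (p%:R - s) / (#|N|%:R - s).
have t0 : 0 <= t by rewrite divr_ge0 //; lra.
have t1 : t <= 1 by rewrite ler_pdivrMr // mul1r; lra.
have le_y j : y j <= y j + t * (1 - y j).
  by rewrite lerDl mulr_ge0 // subr_ge0; have /andP[] := y01 j.
exists (fun j => y j + t * (1 - y j)).
  split=> [i|j]; last first.
    by have := le_y j; have /andP[] := y01 j => *; apply/andP; split; nra.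
  apply: le_trans (le_trans (ycov i) _); last by apply: ler_sum.
  by rewrite ler_wpM2l // lerB.
rewrite big_split /= -mulr_sumr big_split /= sumrN sumr_const -/s.
by rewrite /t mulfVK ?gt_eqF // addrC subrK.
Qed.

(** The constraint of (AFSC) at delta only depends on which distances are at
    most delta, so delta can be lowered to the greatest such distance.  There is
    one: otherwise no point could be covered by others, all y_i would be 1 and
    their sum |N| > p. *)
Lemma distance_below_coverable {R : realType} {N : finType} (d : N -> N -> R)
    (p alpha : nat) (delta : R) :
  (p < #|N|)%N -> (0 < alpha)%N -> coverable d p alpha delta ->
  exists x, [/\ x \in distances d, x <= delta & coverable d p alpha x].
Proof.
move=> pN a0 [y [ycov y01] yp].
pose P (e : N * N) := (e.1 != e.2) && (d e.1 e.2 <= delta).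
have [e0 Pe0|noP] := pickP P; last first.
  exfalso; have y1 i : y i = 1.
    have := ycov i; rewrite big_pred0; last first.
      by move=> j; rewrite eq_sym; apply: (noP (i, j)).
    rewrite pmulr_rle0 ?ltr0n // subr_le0 => y1.
    by apply/le_anti; rewrite y1; have /andP[_ ->] := y01 i.
  move: yp; rewrite /AFSC_objective (eq_bigr _ (fun i _ => y1 i)) sumr_const.
  by rewrite ler_nat leqNgt pN.
case: (arg_maxP (fun e : N * N => d e.1 e.2) Pe0) => -[a b] /andP[/= nab abd].
move=> max_ab; exists (d a b); split=> //.
  by apply/mem_distances; exists a, b.
exists y => //; split=> // i; apply: le_trans (ycov i) _.
rewrite le_eqVlt; apply/orP; left; apply/eqP; apply: eq_bigl => j.
have [//|nji /=] := eqVneq j i.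
apply/idP/idP => [dij|/le_trans]; last exact.
by apply: (max_ab (i, j)); rewrite /P /= eq_sym nji.
Qed.

Lemma APC2Ry_cover {R : realType} {N : finType} (d : N -> N -> R)
    (p alpha m : nat) (u : nat -> R) (y : N -> R) :
  (0 < alpha <= p)%N -> (0 < m <= ndist d)%N ->
  (forall k, (2 <= k <= ndist d)%N -> u k = (k <= m)%N%:R) ->
  APC2Ry_feasible d p alpha (u, y) -> AFSC_feasible d alpha (dist d m) y.
Proof.
move=> /andP[a0 ap] mK um [ysum _ ycov _ y01]; split=> // i.
pose P j := (j != i) && (dist d m < d i j).
have [j0 Pj0|noP] := pickP P; last first.
  (* Every other point is within d_m of i. *)
  rewrite (eq_bigl (fun j => j != i)); last first.
    by move=> j; have := noP j; rewrite /P ltNge; case: (j != i) => //= /negbFE.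
  move: ysum; rewrite (bigD1 i) //= => ysum.
  have /andP[yi0 yi1] := y01 i.
  have a1 : 1 <= alpha%:R :> R by rewrite ler1n.
  have apR : alpha%:R <= p%:R :> R by rewrite ler_nat.
  nra.
case: (arg_minP (fun j => d i j) Pj0) => j /andP[nji mj] min_j.
have [|k kK dk] := @distancesP _ _ d (d i j).
  by apply/mem_distances; exists i, j; rewrite eq_sym.
have mk : (m < k)%N by rewrite -(dist_lt _ _ _ mK kK) dk.
have k2 : (1 < k)%N by apply: leq_ltn_trans mk; case/andP: mK.
have k2K : (2 <= k <= ndist d)%N by rewrite k2; case/andP: kK.
have dk1 : dists_from d i (dist d k).
  split; first by exists j.
  have K0 : (0 < 1 <= ndist d)%N by case/andP: kK => k0; apply: leq_trans.
  move=> /= /eqP; rewrite gt_eqF //.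
  by rewrite dist_lt.
apply: le_trans (ycov i k k2K dk1) _.
rewrite um // leqNgt mk mulr0 add0r le_eqVlt; apply/orP; left; apply/eqP.
(* By the choice of j, no distance from i lies strictly between d_m and d_k. *)
apply: eq_bigl => l; have [//|nli /=] := eqVneq l i.
rewrite dk; apply/idP/idP => [lj|lm]; last exact: le_lt_trans lm mj.
rewrite leNgt; apply/negP => ml.
by have := min_j l; rewrite /P nli ml leNgt lj => /(_ isT).
Qed.

Lemma APC2Ry_of_cover {R : realType} {N : finType} (d : N -> N -> R)
    (p alpha m : nat) (y : N -> R) :
  (0 < m <= ndist d)%N ->
  AFSC_feasible d alpha (dist d m) y -> \sum_j y j = p%:R ->
  APC2Ry_feasible d p alpha (fun k => (k <= m)%N%:R, y).
Proof.
move=> mK [ycov y01] ysum; split=> //.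
- move=> [//|k] _ /=; rewrite ler_nat.
  by case: (ltnP k m) => [/ltnW ->|].
- move=> i k /andP[k2 kK] _; have [km|mk] := leqP k m.
    rewrite mulr1 -[leLHS]addr0; apply: lerD.
      by rewrite ler_piMr // gerBl; have /andP[] := y01 i.
    by apply: sumr_ge0 => j _; have /andP[] := y01 j.
  rewrite mulr0 add0r; apply: le_trans (ycov i) _.
  have dmk : dist d m < dist d k by rewrite dist_lt // kK (ltnW k2).
  rewrite big_mkcond [leRHS]big_mkcond /=; apply: ler_sum => j _.
  have /andP[yj0 _] := y01 j.
  case: (j != i) => //=; case: (leP (d i j) (dist d m)) => [dm|_]; last by case: ifP.
  by rewrite (le_lt_trans dm dmk).
- by move=> k _; case: (k <= m)%N; [right|left].
Qed.

Lemma APC2Ry_values {R : realType} {N : finType} (d : N -> N -> R)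
    (p alpha : nat) :
  (p < #|N|)%N -> (0 < alpha <= p)%N -> (0 < ndist d)%N ->
  APC2Ry_objective d @` APC2Ry_feasible d p alpha =
  [set x | x \in distances d /\ coverable d p alpha x].
Proof.
move=> pN ap K0; apply/seteqP; split=> x /=.
  case=> -[u y] uy <-; have [ysum u_le _ u01 _] := uy.
  have [m mK um] := nonincreasing_binary _ _ K0 u_le u01.
  rewrite (step_objective _ _ _ _ mK um); split; first exact: mem_dist.
  exists y; first exact: APC2Ry_cover ap mK um uy.
  by rewrite /AFSC_objective ysum.
case=> /distancesP[m mK <-] /(AFSC_raise _ _ _ _ pN)[y ycov ysum].
exists (fun k => (k <= m)%N%:R, y); first exact: APC2Ry_of_cover.
exact: step_objective.
Qed.

Theorem theorem20 (R : realType) (N : finType) (d : N -> N -> R)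
    (p alpha : nat) (dstar : R) :
  (forall i j, 0 <= d i j) ->
  (0 < p < #|N|)%N ->
  (0 < alpha <= p)%N ->
  dstar \in distances d ->
  optimal_value (APC2Ry_feasible d p alpha) (APC2Ry_objective d) dstar <->
  least [set delta : R | exists2 y, AFSC_feasible d alpha delta y
                                  & AFSC_objective y <= p%:R] dstar.
Proof.
move=> _ /andP[_ pN] ap dD; rewrite -/(coverable d p alpha).
have K0 : (0 < ndist d)%N by rewrite /ndist; case: (distances d) dD.
rewrite /optimal_value APC2Ry_values //; split=> [[[_ dS] lb]|[dS lb]].
  split=> // delta.
  case/(distance_below_coverable _ _ _ _ pN (proj1 (andP ap))) => x [xD xd xS].
  by apply: le_trans xd; apply: lb.
by split=> // x [_ xS]; apply: lb.
Qed.
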